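(* For every $\varepsilon>0$ one has $$\sum_{n\in\mathbb Z}\psi_4(n)^3\ll P^{13/2+\varepsilon}.$$
   Context: $P$ is a large real parameter, implicit constants depend on $\varepsilon$. With $e(z)=e^{2\pi iz}$, fixed $k\in\{0,1\}$ and $f(\alpha)=\sum_{k\le x\le P}e(\alpha x^4)$ (sum over integers), define $\psi_4(n)=\int_0^1|f(\alpha)|^4e(-\alpha n)\,d\alpha$ for $n\in\mathbb Z$. *)

(* Defs.v *)
From Stdlib Require Export Reals ZArith.
From Coquelicot Require Export Coquelicot.

Open Scope R_scope.

(* exp(2 pi i z) for real z, by Euler's formula: Coquelicot has no complex
   exponential. *)
Definition e (z : R) : C := (cos (2 * PI * z), sin (2 * PI * z)).

(* [Int_part] is the floor.  For k in {0,1} and P >= 0 the integers x with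
   k <= x <= P are the naturals k, ..., floor P, and [sum_n_m] is zero when
   k > floor P. *)
Definition f (k : nat) (P alpha : R) : C :=
  sum_n_m (fun x : nat => e (alpha * INR x ^ 4)) k (Z.to_nat (Int_part P)).

Definition psi4 (k : nat) (P : R) (n : Z) : C :=
  RInt (V := C_R_CompleteNormedModule)
    (fun alpha : R => (RtoC (Cmod (f k P alpha) ^ 4) * e (- (alpha * IZR n)))%C)
    0 1.

(* The two-sided series over Z converges to s; its two halves are required to
   converge separately. *)
Definition is_seriesZ (a : Z -> C) (s : C) : Prop :=
  exists s1 s2 : C,
    is_series (V := C_R_NormedModule) (fun j : nat => a (Z.of_nat j)) s1 /\
    is_series (V := C_R_NormedModule) (fun j : nat => a (- Z.of_nat (S j))%Z) s2 /\
    s = (s1 + s2)%C.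

(* Main.v *)
(** By orthogonality psi_4(n) counts the quadruples with
    x^4 - y^4 - z^4 + w^4 = n, so everything is a statement about integers.
    Put Q for the square of a divisor bound (so Q << P^eps) and m for the number
    of admissible x.

    Weyl differencing, i.e. Cauchy's inequality after fixing the gap h = x - y,
    gives the fourth, sixth and eighth moments Q m^2, Q m^(7/2), Q m^5.
    For a set Z of z integers n at which psi_4(n) >= T, Cauchy bounds (T z)^2 by
    the sixth moment times S, the number of solutions of n + y^4 = n' + y'^4 with
    n, n' in Z. The solutions with y <> y' number s, and Cauchy over the pairs
    (n, y - y') yields s^2 << m z (s + Q z^2), whence
      T^4 z^2 << Q^3 (m^9 + m^8 z).
    Multiplying by T^2 and using T << Q m^2 in the first term and the eighth
    moment bound T^2 z << Q m^5 in the second gives T^3 z << Q^2 m^(13/2), and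
    summing over dyadic T proves the claim. *)

Require Import Defs.
From Stdlib Require Import Reals ZArith Lra.
From Coquelicot Require Import Coquelicot.
From HB Require Import structures.
From mathcomp Require Import all_boot.
From mathcomp Require Import zify ssrZ.

Set Implicit Arguments.
Unset Strict Implicit.
Unset Printing Implicit Defensive.

Local Arguments Z.add : simpl never.
Local Arguments Z.sub : simpl never.
Local Arguments Z.mul : simpl never.
Local Arguments Z.pow : simpl never.
Local Arguments Z.of_nat : simpl never.

(** * Counting collisions *)

Local Open Scope nat_scope.

Lemma cauchy_schwarz_seq (I : Type) (s : seq I) (a b : I -> nat) :
  (\sum_(i <- s) a i * b i) ^ 2 <=
  (\sum_(i <- s) a i ^ 2) * (\sum_(i <- s) b i ^ 2).
Proof.
elim: s => [|i s IH]; first by rewrite !big_nil.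
rewrite !big_cons; move: IH.
set X := \sum_(_ <- _) (_ * _); set A := \sum_(_ <- _) _; set B := \sum_(_ <- _) _.
move=> IH.
(* AM-GM, compared after squaring: the inductive bound X^2 <= A B makes the square of the left side
   at most 4 (a^2 B)(b^2 A). *)
have cross : 2 * (a i * b i * X) <= a i ^ 2 * B + b i ^ 2 * A.
  rewrite -leq_sqr; apply: leq_trans (nat_AGM2 _ _).
  rewrite !expnMn -[2 ^ 2]/4 leq_mul2l /=.
  apply: (@leq_trans (a i ^ 2 * b i ^ 2 * (A * B))); first by rewrite leq_mul2l IH orbT.
  by rewrite (mulnC A B) mulnACA.
rewrite sqrnD mulnDr !mulnDl expnMn; lia.
Qed.

Lemma sum_sqr_le (I : Type) (s : seq I) (a : I -> nat) :
  (\sum_(i <- s) a i) ^ 2 <= size s * \sum_(i <- s) a i ^ 2.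
Proof.
have := cauchy_schwarz_seq s (fun=> 1) a.
by under eq_bigr do rewrite mul1n; rewrite sum1_size.
Qed.

Lemma card_sum_indicator (T : finType) (P : pred T) : #|P| = \sum_a P a.
Proof. by rewrite -sum1_card big_mkcond; apply: eq_bigr => a _; rewrite unfold_in; case: (P a). Qed.

Lemma card_le_size (T : finType) (K : eqType) (P : pred T) (F : T -> K) (s : seq K) :
  {in P &, injective F} -> (forall a, P a -> F a \in s) -> #|P| <= size s.
Proof.
move=> injF Fs; rewrite cardE -(size_map F); apply: uniq_leq_size.
  by rewrite map_inj_in_uniq ?enum_uniq // => x y; rewrite !mem_enum; apply: injF.
by move=> _ /mapP[a + ->]; rewrite mem_enum; apply: Fs.
Qed.

Section Collisions.

Variables (V : eqType).

Definition fibre (A : finType) (phi : A -> V) (v : V) : nat := \sum_a (phi a == v).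

(** The inner product of the two representation functions ([collisions_fibre]), summed over the
    source because [V] may be infinite. *)
Definition collisions (A B : finType) (phi : A -> V) (chi : B -> V) : nat :=
  \sum_a fibre chi (phi a).

Lemma sum_fibre (A : finType) (phi : A -> V) (s : seq V) (F : V -> nat) :
  uniq s ->
  \sum_(v <- s) fibre phi v * F v = \sum_a (phi a \in s) * F (phi a).
Proof.
move=> us; under eq_bigr do rewrite big_distrl.
rewrite exchange_big; apply: eq_bigr => a _ /=.
have [as_|as_] := boolP (phi a \in s).
  rewrite (bigD1_seq (phi a)) //= eqxx big1 ?addn0 // => v /negbTE.
  by rewrite eq_sym => ->.
rewrite big_seq big1 // => v vs; case: eqP => // e.
by rewrite e vs in as_.
Qed.

Lemma sum_fibre_le (A : finType) (phi : A -> V) (s : seq V) (F : V -> nat) :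
  uniq s -> \sum_(v <- s) fibre phi v * F v <= \sum_a F (phi a).
Proof.
by move=> us; rewrite sum_fibre //; apply: leq_sum => a _; case: (_ \in _); rewrite ?mul1n.
Qed.

Lemma sum_fibre_sqr_le (A : finType) (phi : A -> V) (s : seq V) :
  uniq s -> \sum_(v <- s) fibre phi v ^ 2 <= collisions phi phi.
Proof.
move=> us; under eq_bigr do rewrite -mulnn.
exact: (sum_fibre_le phi (fibre phi)).
Qed.

Lemma collisions_fibre (A B : finType) (phi : A -> V) (chi : B -> V) :
  collisions phi chi = \sum_(v <- undup (codom phi)) fibre phi v * fibre chi v.
Proof.
rewrite sum_fibre ?undup_uniq //; apply: eq_bigr => a _.
by rewrite mem_undup codom_f mul1n.
Qed.

Lemma collisions_cauchy (A B : finType) (phi : A -> V) (chi : B -> V) :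
  collisions phi chi ^ 2 <= collisions phi phi * collisions chi chi.
Proof.
rewrite collisions_fibre; apply: leq_trans (cauchy_schwarz_seq _ _ _) _.
by apply: leq_mul; apply: sum_fibre_sqr_le; rewrite undup_uniq.
Qed.

(** Cauchy's inequality over the classes of [key]: only pairs inside a common class survive, at the
    cost of the number of keys. *)
Lemma sum_refine_le (A K : finType) (P : A -> nat) (key : A -> K) :
  (\sum_a P a) ^ 2 <= #|K| * \sum_a \sum_b (key a == key b) * (P a * P b).
Proof.
have -> : \sum_a P a = \sum_(k <- enum K) \sum_(a | key a == k) P a.
  rewrite big_enum (partition_big key predT) //=.
apply: leq_trans (sum_sqr_le _ _) _.
rewrite -cardE leq_mul2l; apply/orP; right.
rewrite big_enum /= (partition_big key predT) //=.
apply: leq_sum => k _; rewrite -mulnn big_distrl /=.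
apply: leq_sum => a /eqP <-; rewrite big_distrr big_mkcond /=.
by apply: leq_sum => b _; rewrite (eq_sym (key a)); case: eqP => _; rewrite ?mul1n.
Qed.

(** [sum_refine_le] applied inside each fibre of [phi]. With the gap as key this is Weyl
    differencing. *)
Lemma collisions_refine (A K : finType) (phi : A -> V) (key : A -> K) :
  collisions phi phi <=
  #|K| * \sum_a \sum_b (key a == key b) * (phi a == phi b).
Proof.
rewrite collisions_fibre.
apply: leq_trans.
  apply: leq_sum => v _; rewrite mulnn.
  exact: (sum_refine_le (fun a => nat_of_bool (phi a == v)) key).
rewrite -big_distrr leq_mul2l /=; apply/orP; right.
rewrite exchange_big; apply: leq_sum => a _ /=.
rewrite exchange_big; apply: leq_sum => b _ /=.
rewrite -big_distrr leq_mul2l /=; apply/orP; right.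
rewrite (bigD1_seq (phi a)) ?undup_uniq ?mem_undup ?codom_f //= eqxx mul1n (eq_sym (phi b)).
rewrite big1 ?addn0 // => v /negbTE.
by rewrite eq_sym => ->.
Qed.

End Collisions.

(** * Differences of fourth powers *)

(** Both signs are kept because the gaps that will divide n may be negative. *)
Definition signed_divisors (n : Z) : seq Z :=
  [seq Z.of_nat d | d <- divisors (Z.abs_nat n)] ++
  [seq (- Z.of_nat d)%Z | d <- divisors (Z.abs_nat n)].

Lemma size_signed_divisors (n : Z) :
  size (signed_divisors n) = 2 * size (divisors (Z.abs_nat n)).
Proof. by rewrite size_cat !size_map mul2n addnn. Qed.

Lemma mem_signed_divisors (n h c : Z) :
  n <> 0%Z -> n = (h * c)%Z -> h \in signed_divisors n.
Proof.
move=> n0 nE; have hdiv : Z.abs_nat h \in divisors (Z.abs_nat n).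
  rewrite -dvdn_divisors; last by lia.
  by apply/dvdnP; exists (Z.abs_nat c); rewrite nE Zabs2Nat.inj_mul mulnC.
rewrite mem_cat; have [h0|h0] := Z_le_gt_dec 0 h; apply/orP; [left|right];
  by apply/mapP; exists (Z.abs_nat h) => //; lia.
Qed.

Section Quartics.

Variables (k m : nat).
Implicit Types (x y : 'I_m) (p : 'I_m * 'I_m) (q : ('I_m * 'I_m) * ('I_m * 'I_m)).

Definition base x : Z := Z.of_nat (k + x).
Definition diff4 p : Z := (base p.1 ^ 4 - base p.2 ^ 4)%Z.
Definition quad4 q : Z := (diff4 q.1 - diff4 q.2)%Z.
Definition gap p : Z := (base p.1 - base p.2)%Z.

Lemma base_ge0 x : (0 <= base x)%Z.
Proof. by rewrite /base; lia. Qed.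
Arguments base_ge0 : clear implicits.

Lemma base_inj : injective base.
Proof. by move=> x y; rewrite /base => e; apply: val_inj => /=; lia. Qed.

Lemma diff4_factor p :
  diff4 p = (gap p * ((base p.1 + base p.2) * (base p.1 ^ 2 + base p.2 ^ 2)))%Z.
Proof. rewrite /diff4 /gap; ring. Qed.

(** Both x - y and x + y divide n = x^4 - y^4, and together they determine (x, y). *)
Lemma diff4_count (n : Z) :
  n <> 0%Z -> #|[pred p | diff4 p == n]| <= size (signed_divisors n) ^ 2.
Proof.
move=> n0; rewrite -mulnn -(size_allpairs pair).
apply: (card_le_size (F := fun p => (gap p, base p.1 + base p.2)%Z)).
- move=> [x y] [x' y'] _ _ [] /= e1 e2; rewrite /gap /= in e1.
  by congr pair; apply: base_inj; lia.
- move=> p /= /eqP pn; apply: allpairs_f; rewrite -?pn.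
    by apply: (mem_signed_divisors _ (diff4_factor p)); rewrite pn.
  apply: (mem_signed_divisors _ (etrans (diff4_factor p) (Z.mul_shuffle3 _ _ _))).
  by rewrite pn.
Qed.

(* With h = x - y = x' - y', d = y - y' and w = y + x', the difference of two
   gap-h values is h d (3 w^2 + h^2 + d^2), and w >= 0 is determined by it. *)
Lemma quad4_factor q :
  gap q.1 = gap q.2 ->
  quad4 q = (gap q.1 * ((base q.1.2 - base q.2.2) *
    (3 * (base q.1.2 + base q.2.1) ^ 2 + gap q.1 ^ 2 +
     (base q.1.2 - base q.2.2) ^ 2)))%Z.
Proof.
case: q => [[x y] [x' y']]; rewrite /gap /quad4 /diff4 /=.
move: (base x) (base y) (base x') (base y') => a b a' b' gapE.
have -> : a = (b + (a' - b'))%Z by lia.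
ring.
Qed.

(** In the notation of [quad4_factor], h and d are divisors of n. With n and w >= 0 they determine
    w, and h, d, w determine q. *)
Lemma quad4_count (n : Z) :
  n <> 0%Z ->
  #|[pred q | (gap q.1 == gap q.2) && (quad4 q == n)]| <=
  size (signed_divisors n) ^ 2.
Proof.
move=> n0; rewrite -mulnn -(size_allpairs pair).
apply: (card_le_size (F := fun q => (gap q.1, base q.1.2 - base q.2.2)%Z)).
- move=> q r /andP[/eqP qg /eqP qn] /andP[/eqP rg /eqP rn] [] e1 e2.
  have qf := quad4_factor qg; have rf := quad4_factor rg.
  rewrite qn in qf; rewrite rn -e1 -e2 in rf.
  have wE : (base q.1.2 + base q.2.1 = base r.1.2 + base r.2.1)%Z.
    have := base_ge0 q.1.2; have := base_ge0 q.2.1.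
    have := base_ge0 r.1.2; have := base_ge0 r.2.1.
    move: qf rf; set u := base q.1.2; set u' := base q.2.1.
    set t := base r.1.2; set t' := base r.2.1.
    set h := gap q.1; set d := (u - _)%Z => qf rf t0 t'0 u0 u'0.
    have h0 : h <> 0%Z by move=> h0; apply: n0; rewrite qf h0.
    have d0 : d <> 0%Z by move=> d0; apply: n0; rewrite qf d0; ring.
    have := etrans (esym qf) rf.
    move=> /(Z.mul_reg_l _ _ _ h0) /(Z.mul_reg_l _ _ _ d0) eq2.
    by nia.
  move: qg rg e1 e2 wE {qn rn qf rf}.
  case: q r => [[x y] [x' y']] [[z w] [z' w']]; rewrite /gap /= => *.
  by congr (_, _, (_, _)); apply: base_inj; lia.
- move=> q /andP[/eqP qg /eqP qn]; apply: allpairs_f.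
    by apply: mem_signed_divisors n0 _; rewrite -qn quad4_factor.
  apply: (mem_signed_divisors n0); rewrite -qn quad4_factor //.
  exact: Z.mul_shuffle3.
Qed.

(** If h and d were both nonzero, every factor in [quad4_factor] would be nonzero, 3 w^2 + h^2 + d^2
    being positive. Hence d = 0, and equal gaps make the pairs coincide. *)
Lemma quad4_rigid q :
  gap q.1 = gap q.2 -> gap q.1 <> 0%Z -> quad4 q = 0%Z -> q.1 = q.2.
Proof.
move=> qg h0 q0; have := quad4_factor qg; rewrite q0.
set h := gap q.1 in h0 *; set d := (_ - _)%Z; set w := (base q.1.2 + _)%Z => e.
have d0 : d = 0%Z.
  case: (Z.eq_dec d 0) => // d0; exfalso.
  have sum_gt0 : (0 < 3 * w ^ 2 + h ^ 2 + d ^ 2)%Z.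
    move: d0 {e}; clearbody h d w => d0; rewrite !Z.pow_2_r.
    have := Z.square_nonneg w; have := Z.square_nonneg h.
    have : (0 < d * d)%Z by nia.
    lia.
  by move: (esym e) => /Z.eq_mul_0[|/Z.eq_mul_0[]]; lia.
move: qg d0 {q0 e h0}; rewrite /d {h d w}.
case: q => [[x y] [x' y']]; rewrite /gap /= => *.
by congr (_, _); apply: base_inj; lia.
Qed.

Lemma gap_key_subproof p : p.1 + (m - p.2) < m + m.
Proof. by case: p => [[x xm] [y ym]] /=; lia. Qed.

(** The gap shifted by m, so that it takes values in a finite type of 2m keys. *)
Definition gap_key p : 'I_(m + m) := Ordinal (gap_key_subproof p).

Lemma gap_keyE p p' : (gap_key p == gap_key p') = (gap p == gap p').
Proof.
case: p p' => [[x xm] [y ym]] [[x' x'm] [y' y'm]].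
apply/eqP/eqP; rewrite /gap /base /=.
  by case=> e; lia.
by move=> e; apply: val_inj => /=; lia.
Qed.

Lemma eq_diff4 p : diff4 p = 0%Z -> p.1 = p.2.
Proof.
rewrite /diff4 => e; apply: base_inj.
by apply: (Z.pow_inj_l _ _ 4); [exact: base_ge0 | exact: base_ge0 | lia | lia].
Qed.

End Quartics.

(** * Even moments *)

Lemma sum_pair (A B : finType) (F : A * B -> nat) :
  \sum_q F q = \sum_a \sum_b F (a, b).
Proof. by rewrite pair_bigA; apply: eq_bigr => -[]. Qed.

(** Regroups the variables of an equation, so that terms can be moved from one side to the other. *)
Lemma sum_pair_transpose (A B C D : finType) (F : A -> B -> C -> D -> nat) :
  \sum_(q : A * B) \sum_(r : C * D) F q.1 q.2 r.1 r.2 =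
  \sum_(q : A * C) \sum_(r : B * D) F q.1 r.1 q.2 r.2.
Proof.
rewrite !sum_pair /=; apply: eq_bigr => a _.
under eq_bigr do rewrite sum_pair /=.
under [RHS]eq_bigr do rewrite sum_pair /=.
exact: exchange_big.
Qed.

Lemma Z_sub_eq_exchange (a b c d : Z) : (b - d == a - c)%Z = (c - d == a - b)%Z.
Proof. by apply/eqP/eqP; lia. Qed.

Section Moments.

Variables (k m : nat).

Notation phi := (@diff4 k m).
Notation quad := (@quad4 k m).

Lemma diff4_abs_le p : (Z.abs (phi p) <= Z.of_nat (k + m) ^ 4)%Z.
Proof.
have base_le (x : 'I_m) : (0 <= base k x ^ 4 <= Z.of_nat (k + m) ^ 4)%Z.
  split; first by apply: Z.pow_nonneg; apply: base_ge0.
  by apply: Z.pow_le_mono_l; case: x => x xm; rewrite /base /=; lia.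
by have := base_le p.1; have := base_le p.2; rewrite /diff4; lia.
Qed.
Arguments diff4_abs_le : clear implicits.

Lemma quad4_abs_le q : (Z.abs (quad q) <= 2 * Z.of_nat (k + m) ^ 4)%Z.
Proof.
by have := diff4_abs_le q.1; have := diff4_abs_le q.2; rewrite /quad4; lia.
Qed.
Arguments quad4_abs_le : clear implicits.

Lemma fibre_diff4_0 : fibre phi 0%Z <= m.
Proof.
rewrite /fibre -(card_sum_indicator [pred p | phi p == 0%Z]).
rewrite -[X in _ <= X]size_enum_ord.
apply: (card_le_size (F := fst)) => [|p _]; last by rewrite mem_enum.
by move=> [x y] [x' y'] /eqP/eq_diff4 /= <- /eqP/eq_diff4 /= <- ->.
Qed.

(** The range 4 (k + m)^4 admits differences of two values of [quad4], each at most 2 (k + m)^4 in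
    absolute value. *)
Variable Q : nat.
Hypothesis Q_gt0 : 0 < Q.
Hypothesis divisors_le : forall n : Z, n <> 0%Z ->
  (Z.abs n <= 4 * Z.of_nat (k + m) ^ 4)%Z -> size (signed_divisors n) ^ 2 <= Q.

Lemma fibre_diff4_le (n : Z) :
  (Z.abs n <= 4 * Z.of_nat (k + m) ^ 4)%Z ->
  fibre phi n <= Q + (n == 0%Z) * m.
Proof.
move=> nB; case: eqP => [->|n0]; first by rewrite mul1n (leq_trans fibre_diff4_0) ?leq_addl.
rewrite /fibre -(card_sum_indicator [pred p | phi p == n]) mul0n addn0.
have le_Q := divisors_le n0 nB.
exact: leq_trans (diff4_count k m n0) le_Q.
Qed.

(** Nonzero values have fibres of size at most Q. The value 0 is taken only on the m diagonal pairs,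
    which adds at most m^2. *)
Lemma fourth_moment_le : collisions phi phi <= 2 * Q * m ^ 2.
Proof.
have le p : fibre phi (phi p) <= Q + (phi p == 0%Z) * m.
  by apply: fibre_diff4_le; have := diff4_abs_le p; lia.
apply: leq_trans; first by apply: leq_sum => p _; apply: le.
rewrite big_split sum_nat_const /= -big_distrl card_prod card_ord /= mulnn.
apply: (@leq_trans (m ^ 2 * Q + m * m)); first by rewrite leq_add2l leq_mul ?fibre_diff4_0.
nia.
Qed.

(** The fibre counts collisions of [phi] with its translate by n; Cauchy-Schwarz bounds it by the
    untranslated count, the fourth moment. *)
Lemma fibre_quad4_le (n : Z) : fibre quad n <= 2 * Q * m ^ 2.
Proof.
have -> : fibre quad n = collisions phi (fun p => n + phi p)%Z.
  rewrite /fibre sum_pair; apply: eq_bigr => p _; apply: eq_bigr => p' _.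
  by congr nat_of_bool; rewrite /quad4 /=; apply/eqP/eqP; lia.
rewrite -leq_sqr; apply: leq_trans (collisions_cauchy _ _) _; rewrite -mulnn.
have -> : collisions (fun p => n + phi p)%Z (fun p => n + phi p)%Z = collisions phi phi.
  apply: eq_bigr => p _; apply: eq_bigr => p' _.
  by congr nat_of_bool; apply/eqP/eqP; lia.
by rewrite leq_mul // fourth_moment_le.
Qed.

(** For n = 0, [quad4_rigid] leaves two families of size m^2: equal pairs, or both gaps zero. The
    boolean tag in the injection separates them. *)
Lemma quad4_gap_count (n : Z) :
  (Z.abs n <= 4 * Z.of_nat (k + m) ^ 4)%Z ->
  #|[pred q | (gap k q.1 == gap k q.2) && (quad q == n)]| <=
  Q + (n == 0%Z) * (2 * m ^ 2).
Proof.
move=> nB; case: eqP => [->|n0]; last first.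
  have le_Q := divisors_le n0 nB.
  by rewrite mul0n addn0; apply: leq_trans (quad4_count k m n0) le_Q.
rewrite mul1n; apply: leq_trans (leq_addl _ _).
have -> : 2 * m ^ 2 = size (enum {: bool * ('I_m * 'I_m)}).
  by rewrite -cardE !card_prod card_bool card_ord mulnn.
apply: (card_le_size (F := fun q =>
  if q.1 == q.2 then (true, q.1) else (false, (q.1.1, q.2.1)))).
  have diag q : (gap k q.1 == gap k q.2) && (quad q == 0%Z) -> q.1 <> q.2 ->
      q.1.1 = q.1.2 /\ q.2.1 = q.2.2.
    move=> /andP[/eqP qg /eqP q0] neq.
    have h0 : gap k q.1 = 0%Z.
      by case: (Z.eq_dec (gap k q.1) 0) => // h0; case: neq; apply: (quad4_rigid qg h0 q0).
    by split; apply: (@base_inj k); move: qg h0; rewrite /gap; lia.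
  move=> q r Pq Pr; case: eqP => [eq|/(diag _ Pq)[e1 e2]];
    case: eqP => [er|/(diag _ Pr)[e3 e4]] // [].
    by case: q r eq er {Pq Pr} => [q1 q2] [r1 r2] /= <- <- ->.
  case: q r e1 e2 e3 e4 {Pq Pr} => [[x y] [x' y']] [[z w] [z' w']] /=.
  by move=> <- <- <- <- -> ->.
by move=> q _; rewrite mem_enum.
Qed.

(** After differencing by the gap of the first pair, transposition turns the equation into
    [quad q = quad r] with a gap condition on q alone. The m^4 choices of r give Q m^4, those with
    [quad r = 0] at most 4 Q m^4 more, and there are 2m keys. *)
Lemma eighth_moment_le : collisions quad quad <= 10 * Q * m ^ 5.
Proof.
apply: leq_trans; first exact: (collisions_refine quad (fun q => gap_key q.1)).
have -> : \sum_q \sum_r (gap_key q.1 == gap_key r.1) * (quad q == quad r) =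
    \sum_r #|[pred q | (gap k q.1 == gap k q.2) && (quad q == quad r)]|.
  rewrite (sum_pair_transpose (fun p p2 p' p2' => (gap_key p == gap_key p') *
    (phi p - phi p2 == phi p' - phi p2')%Z)) exchange_big.
  apply: eq_bigr => r _; rewrite card_sum_indicator; apply: eq_bigr => q _ /=.
  rewrite (gap_keyE k) mulnb; congr (nat_of_bool (_ && _)); rewrite /quad4.
  by apply/eqP/eqP; lia.
rewrite card_ord.
have le r : #|[pred q | (gap k q.1 == gap k q.2) && (quad q == quad r)]| <=
    Q + (quad r == 0%Z) * (2 * m ^ 2).
  by apply: quad4_gap_count; have := quad4_abs_le r; lia.
apply: leq_trans; first by apply: leq_mul (leqnn _) _; apply: leq_sum => r _; apply: le.
rewrite big_split sum_nat_const /= -big_distrl !card_prod card_ord /=.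
have := fibre_quad4_le 0%Z; rewrite /fibre; set J := \sum_r _ => JQ.
apply: (@leq_trans ((m + m) * (m * m * (m * m) * Q + 2 * Q * m ^ 2 * (2 * m ^ 2)))).
  by rewrite leq_mul2l leq_add2l leq_mul2r JQ !orbT.
by rewrite !expnS; lia.
Qed.

(** The part of [quad4 ((x, y), p) = n] left after moving y^4 over: n + y^4 = [triple4 (x, p)]. *)
Definition triple4 (a : 'I_m * ('I_m * 'I_m)) : Z := (base k a.1 ^ 4 - phi a.2)%Z.

(** Transposing x^4 - phi p = y^4 - phi p' gives a collision of [phi] with [quad], to which
    Cauchy-Schwarz applies with the fourth and eighth moments. *)
Lemma sixth_moment_le : collisions triple4 triple4 ^ 2 <= 20 * Q ^ 2 * m ^ 7.
Proof.
have -> : collisions triple4 triple4 = collisions phi quad.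
  rewrite /collisions /fibre.
  rewrite (sum_pair_transpose (fun x p y p' =>
    (base k y ^ 4 - phi p' == base k x ^ 4 - phi p)%Z : nat)).
  apply: eq_bigr => q _; apply: eq_bigr => r _; congr nat_of_bool.
  exact: Z_sub_eq_exchange.
apply: leq_trans (collisions_cauchy _ _) _.
apply: leq_trans (leq_mul fourth_moment_le eighth_moment_le) _.
by rewrite !expnS; lia.
Qed.

End Moments.

(** * Large values *)

Lemma level_set_arith (m z Q T S s J6 : nat) :
  0 < z -> T <= 2 * Q * m ^ 2 -> T ^ 2 * z <= 10 * Q * m ^ 5 ->
  s ^ 2 <= 2 * m * z * (s + z ^ 2 * Q) -> S <= m * z + s ->
  J6 ^ 2 <= 20 * Q ^ 2 * m ^ 7 -> (T * z) ^ 2 <= J6 * S ->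
  (T ^ 3 * z) ^ 2 <= 24 * (100 * (Q ^ 4 * m ^ 13)).
Proof.
move=> z_gt0 T_le T2z_le s_le S_le J6_le Tz_le.
(* AM-GM absorbs the term 2 m z s into s^2, leaving s^2 <= 4 (m z)^2 + 4 m z^3 Q; then S^2 <= 2 (m
   z)^2 + 2 s^2. *)
have S2_le : S ^ 2 <= 10 * (m * z) ^ 2 + 8 * m * z ^ 3 * Q.
  have agm : 2 * (2 * m * z * s) <= (2 * m * z) ^ 2 + s ^ 2 by apply: nat_Cauchy.
  have : S ^ 2 <= (m * z + s) ^ 2 by rewrite leq_sqr.
  have : 2 * (m * z * s) <= (m * z) ^ 2 + s ^ 2 by apply: nat_Cauchy.
  by move: agm s_le; rewrite !expnS expn0 !muln1; nia.
(* From (T z)^4 <= J6^2 S^2, where z^2 cancels on both sides. *)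
have T4z2_le : T ^ 4 * z ^ 2 <= 200 * Q ^ 2 * m ^ 9 + 160 * Q ^ 3 * m ^ 8 * z.
  rewrite -(@leq_pmul2r (z ^ 2)) ?expn_gt0 ?z_gt0 //.
  apply: (@leq_trans ((J6 * S) ^ 2)).
    apply: (@leq_trans (((T * z) ^ 2) ^ 2)); last by rewrite leq_sqr.
    by rewrite -expnM !expnMn -mulnA -expnD.
  rewrite expnMn; apply: leq_trans (leq_mul J6_le S2_le) _.
  by rewrite !expnS expn0; lia.
have -> : (T ^ 3 * z) ^ 2 = T ^ 2 * (T ^ 4 * z ^ 2).
  by rewrite expnMn mulnA -expnD -expnM.
apply: leq_trans (leq_mul (leqnn _) T4z2_le) _.
have low : T ^ 2 * (200 * Q ^ 2 * m ^ 9) <= 8 * (100 * (Q ^ 4 * m ^ 13)).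
  apply: (@leq_trans ((2 * Q * m ^ 2) ^ 2 * (200 * Q ^ 2 * m ^ 9))).
    by rewrite leq_mul2r leq_sqr T_le orbT.
  by rewrite !expnS expn0; lia.
have high : T ^ 2 * z * (160 * Q ^ 3 * m ^ 8) <= 16 * (100 * (Q ^ 4 * m ^ 13)).
  apply: leq_trans (leq_mul T2z_le (leqnn _)) _.
  by rewrite !expnS expn0; lia.
have {}high : T ^ 2 * (160 * Q ^ 3 * m ^ 8 * z) <= 16 * (100 * (Q ^ 4 * m ^ 13)).
  by apply: leq_trans high; rewrite (mulnC _ z) mulnA.
by rewrite mulnDr -[24]/(8 + 16) mulnDl leq_add.
Qed.

Lemma Z_shift_eq (x y p n : Z) : ((x - y) - p == n)%Z = (n + y == x - p)%Z.
Proof. by apply/eqP/eqP; lia. Qed.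

Lemma Z_add_eq_exchange (a b x y : Z) : (b + y == a + x)%Z = (x - y == b - a)%Z.
Proof. by apply/eqP/eqP; lia. Qed.

Section LevelSets.

Variables (k m Q : nat).
Hypothesis Q_gt0 : 0 < Q.
Hypothesis divisors_le : forall n : Z, n <> 0%Z ->
  (Z.abs n <= 4 * Z.of_nat (k + m) ^ 4)%Z -> size (signed_divisors n) ^ 2 <= Q.

Notation phi := (@diff4 k m).
Notation quad := (@quad4 k m).

Variables (I : finType) (nu : I -> Z).
Hypothesis nu_inj : injective nu.
Hypothesis nu_le : forall i, (Z.abs (nu i) <= 2 * Z.of_nat (k + m) ^ 4)%Z.

Definition shift4 (a : I * 'I_m) : Z := (nu a.1 + base k a.2 ^ 4)%Z.

Lemma sum_fibre_quad4 :
  \sum_i fibre quad (nu i) = collisions (@triple4 k m) shift4.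
Proof.
rewrite exchange_big sum_pair sum_pair [RHS]sum_pair; apply: eq_bigr => x _ /=.
rewrite exchange_big; apply: eq_bigr => p' _ /=.
rewrite /fibre sum_pair exchange_big; apply: eq_bigr => i _; apply: eq_bigr => y _.
by congr nat_of_bool; exact: Z_shift_eq.
Qed.

(** Solutions of nu i + y^4 = nu i' + y'^4 with i <> i'. Since [nu] is injective, this excludes
    exactly the solutions with y = y'. *)
Definition offdiag (w : (I * I) * ('I_m * 'I_m)) : nat :=
  (w.1.1 != w.1.2) && (phi w.2 == nu w.1.2 - nu w.1.1)%Z.

Lemma shift4_collisions :
  collisions shift4 shift4 <= m * #|I| + \sum_w offdiag w.
Proof.
have -> : collisions shift4 shift4 = \sum_(p : I * I) fibre phi (nu p.2 - nu p.1)%Z.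
  rewrite /collisions /fibre.
  rewrite (sum_pair_transpose (fun i y i' y' =>
    (nu i' + base k y' ^ 4 == nu i + base k y ^ 4)%Z : nat)).
  apply: eq_bigr => p _; apply: eq_bigr => r _; congr nat_of_bool.
  exact: Z_add_eq_exchange.
have -> : m * #|I| = \sum_(p : I * I) (p.1 == p.2) * m.
  rewrite sum_pair mulnC -sum_nat_const; apply: eq_bigr => i _.
  rewrite (bigD1 i) //= eqxx mul1n big1 ?addn0 // => j /negbTE.
  by rewrite eq_sym => ->.
rewrite [X in _ <= _ + X]sum_pair -big_split /=.
apply: leq_sum => -[i j] _ /=; rewrite /offdiag /=.
case: eqP => [->|_] /=; last by rewrite mul0n add0n.
by rewrite Z.sub_diag mul1n (leq_trans (fibre_diff4_0 k m)) ?leq_addr.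
Qed.

(* Two solutions sharing n and the gap h = y - y' satisfy
   quad4 (r, r') = n2 - n2', so either they coincide or a divisor of the
   nonzero integer n2 - n2' determines them. *)
Lemma offdiag_sqr_le :
  (\sum_w offdiag w) ^ 2 <= 2 * m * #|I| * (\sum_w offdiag w + #|I| ^ 2 * Q).
Proof.
pose key (w : (I * I) * ('I_m * 'I_m)) := (w.1.1, gap_key w.2).
pose cross (i i2 i' i2' : I) (r r' : 'I_m * 'I_m) : nat :=
  (i2 != i2') * ((i == i') * (nu i == nu i2 - phi r)%Z *
    ((gap k r == gap k r') && (quad (r, r') == nu i2 - nu i2')%Z)).
apply: leq_trans; first exact: (sum_refine_le offdiag key).
rewrite card_prod card_ord.
have -> : #|I| * (m + m) = 2 * m * #|I| by lia.
rewrite leq_mul2l; apply/orP; right.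
(* As i <> i2, the gap of r is nonzero. So i2 = i2' forces r = r' by [quad4_rigid]; every other pair
   is counted by [cross]. *)
have pointwise w w' : (key w == key w') * (offdiag w * offdiag w') <=
    (w == w') * offdiag w + cross w.1.1 w.1.2 w'.1.1 w'.1.2 w.2 w'.2.
  case: w w' => [[i i2] r] [[i' i2'] r']; rewrite /key /offdiag /= xpair_eqE (gap_keyE k).
  case: eqP => [<-|//] /=; case: (gap k r =P _) => [rg|//] /=.
  case: (i =P i2) => [//|ne]; case: (i =P i2') => [_|ne']; first by rewrite !muln0.
  rewrite !mul1n /=; case: (phi r =P _) => [e|//]; case: (phi r' =P _) => [e'|//] /=.
  case: (i2 =P i2') => [e2|ne2].
    have -> : r = r'; last by rewrite -e2 eqxx.
    apply: (@quad4_rigid k m (r, r')) => //=; last by rewrite /quad4 /= e e' e2 Z.sub_diag.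
    by move=> h0; apply: ne; apply: nu_inj; move: (diff4_factor k r); rewrite e h0 Z.mul_0_l; lia.
  apply: leq_trans (leq_addl _ _); rewrite /cross (introN eqP ne2) rg eqxx.
  have -> : (nu i == nu i2 - phi r)%Z by apply/eqP; rewrite e; lia.
  have -> : (quad (r, r') == nu i2 - nu i2')%Z by apply/eqP; rewrite /quad4 /= e e'; lia.
  by rewrite eqxx.
apply: leq_trans.
  by apply: leq_sum => w _; apply: leq_sum => w' _; exact: pointwise.
under eq_bigr do rewrite big_split /=.
rewrite big_split /=; apply: leq_add.
  apply: leq_sum => w _; rewrite (bigD1 w) //= eqxx mul1n big1 ?addn0 // => w' /negbTE.
  by rewrite eq_sym => ->.
rewrite (sum_pair_transpose (fun p r p' r' => cross p.1 p.2 p'.1 p'.2 r r')).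
rewrite exchange_big /=.
(* The pair (i2, i2') is brought outermost: each of the [#|I| ^ 2] choices is to contribute at most
   Q. *)
under eq_bigr => r _ do rewrite sum_pair (sum_pair_transpose (fun i i2 i' i2' => cross i i2 i' i2' r.1 r.2)) exchange_big.
rewrite exchange_big /=.
have -> : #|I| ^ 2 * Q = \sum_(j : I * I) Q by rewrite sum_nat_const card_prod mulnn.
apply: leq_sum => -[i2 i2'] _ /=; rewrite /cross.
case: (i2 =P i2') => [_|ne2] /=; first by rewrite big1 // => r _; rewrite big1.
pose n := (nu i2 - nu i2')%Z.
have n0 : n <> 0%Z by move=> n0; apply: ne2; apply: nu_inj; rewrite /n in n0; lia.
have nB : (Z.abs n <= 4 * Z.of_nat (k + m) ^ 4)%Z.
  by rewrite /n; have := @nu_le i2; have := @nu_le i2'; lia.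
apply: (@leq_trans #|[pred q | (gap k q.1 == gap k q.2) && (quad q == n)]|); last first.
  by apply: leq_trans (quad4_count k m n0) _; exact: divisors_le.
rewrite card_sum_indicator; apply: leq_sum => -[r r'] _ /=; rewrite -/n.
(* Given i2 and r, the value [nu i] is prescribed, so at most one i remains. *)
under eq_bigr do rewrite mul1n.
rewrite -big_distrl /= -[X in _ <= X]mul1n leq_mul2r; apply/orP; right.
rewrite sum_pair.
under eq_bigr => i _.
  rewrite (bigD1 i) //= eqxx mul1n big1 ?addn0; last first.
    by move=> j /negbTE; rewrite eq_sym => ->.
  over.
rewrite -(card_sum_indicator [pred i | nu i == nu i2 - phi r]%Z) /=.
by apply/card_le1_eqP => i j /eqP ei /eqP ej; apply: nu_inj; rewrite ei ej.
Qed.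

Variable T : nat.
Hypothesis T_le : forall i, T <= fibre quad (nu i).

Lemma level_set_second_moment : T ^ 2 * #|I| <= 10 * Q * m ^ 5.
Proof.
apply: leq_trans (eighth_moment_le Q_gt0 divisors_le).
have us : uniq [seq nu i | i <- enum I] by rewrite map_inj_uniq ?enum_uniq.
apply: leq_trans (sum_fibre_sqr_le _ us).
rewrite big_map big_enum /= mulnC -sum_nat_const.
by apply: leq_sum => i _; rewrite leq_sqr.
Qed.

Lemma level_set_first_moment :
  (T * #|I|) ^ 2 <=
  collisions (@triple4 k m) (@triple4 k m) * collisions shift4 shift4.
Proof.
apply: leq_trans (collisions_cauchy _ _); rewrite -sum_fibre_quad4 leq_sqr.
by rewrite mulnC -sum_nat_const; apply: leq_sum => i _.
Qed.

Lemma level_set_le : (T ^ 3 * #|I|) ^ 2 <= 24 * (100 * (Q ^ 4 * m ^ 13)).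
Proof.
(* An element of the level set is needed both to cancel z and to bound T by an actual fibre. *)
have [z0|z_gt0] := posnP #|I|; first by rewrite z0 muln0.
have T2 : T <= 2 * Q * m ^ 2.
  have /card_gt0P[i _] := z_gt0.
  exact: leq_trans (T_le i) (fibre_quad4_le Q_gt0 divisors_le _).
have := level_set_first_moment; have := sixth_moment_le Q_gt0 divisors_le.
have := shift4_collisions; have := offdiag_sqr_le; have := level_set_second_moment.
by do 5!move=> ?; apply: (@level_set_arith m #|I| Q T (collisions shift4 shift4) (\sum_w offdiag w)); eauto.
Qed.

End LevelSets.

(** * Dyadic summation over level sets *)

Section ThirdMoment.

Variables (k m Q : nat).
Hypothesis Q_gt0 : 0 < Q.
Hypothesis divisors_le : forall n : Z, n <> 0%Z ->
  (Z.abs n <= 4 * Z.of_nat (k + m) ^ 4)%Z -> size (signed_divisors n) ^ 2 <= Q.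

Notation quad := (@quad4 k m).

Lemma fibre_quad4_gt0 (n : Z) :
  0 < fibre quad n -> (Z.abs n <= 2 * Z.of_nat (k + m) ^ 4)%Z.
Proof.
rewrite lt0n sum_nat_eq0 negb_forall => /existsP[q].
case: (quad q =P n) => [<- _|//]; exact: (@quad4_abs_le k m q).
Qed.

Lemma fibre_quad4_le_card (n : Z) : fibre quad n <= m ^ 4.
Proof.
rewrite /fibre -(card_sum_indicator [pred q | quad q == n]).
by apply: leq_trans (max_card _) _; rewrite !card_prod card_ord !mulnn -expnM.
Qed.

(** The single term with 2^j <= v < 2^(j+1) suffices, and 8 is the cube of 2. *)
Lemma dyadic_cube_le (v L : nat) :
  v < 2 ^ L -> v ^ 3 <= 8 * \sum_(j < L) (2 ^ j) ^ 3 * (2 ^ j <= v).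
Proof.
have [->|v_gt0] := posnP v; first by [].
have /andP[lo hi] := trunc_log_bounds (isT : 1 < 2) v_gt0.
set j := trunc_log 2 v in lo hi => vL.
have jL : j < L by rewrite -(ltn_exp2l j L (isT : 1 < 2)); apply: leq_ltn_trans vL.
rewrite (bigD1 (Ordinal jL)) //= lo muln1 mulnDr.
apply: leq_trans (leq_addr _ _).
have -> : 8 * (2 ^ j) ^ 3 = (2 ^ j.+1) ^ 3 by rewrite (expnS 2) expnMn.
by rewrite leq_exp2r // ltnW.
Qed.

(** Each of the L dyadic levels is bounded by [level_set_le]. Cauchy over the levels gives L^2, and
    64 is the square of the dyadic loss 8. *)
Lemma third_moment_le (s : seq Z) : uniq s ->
  (\sum_(n <- s) fibre quad n ^ 3) ^ 2 <=
  64 * (trunc_log 2 (m ^ 4)).+1 ^ 2 * (24 * (100 * (Q ^ 4 * m ^ 13))).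
Proof.
move=> us; set L := (trunc_log 2 _).+1; set c := 24 * (100 * _).
pose t (j : nat) := (2 ^ j) ^ 3 * size [seq n <- s | 2 ^ j <= fibre quad n].
have t_le j : t j ^ 2 <= c.
  pose sj := [seq n <- s | 2 ^ j <= fibre quad n].
  have usj : uniq sj by apply: filter_uniq.
  rewrite /t -/sj -[size sj]card_ord.
  apply: (level_set_le Q_gt0 divisors_le (nu := fun i : 'I_(size sj) => nth 0%Z sj i)).
  - by move=> i i' /eqP; rewrite nth_uniq // => /eqP /val_inj.
  - move=> i; apply: fibre_quad4_gt0.
    have := mem_nth 0%Z (ltn_ord i); rewrite mem_filter => /andP[+ _].
    by apply: leq_trans; rewrite expn_gt0.
  - by move=> i; have := mem_nth 0%Z (ltn_ord i); rewrite mem_filter => /andP[].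
have le_sum : \sum_(n <- s) fibre quad n ^ 3 <= 8 * \sum_(j < L) t j.
  have -> : \sum_(j < L) t j =
      \sum_(n <- s) \sum_(j < L) (2 ^ j) ^ 3 * (2 ^ j <= fibre quad n).
    rewrite exchange_big; apply: eq_bigr => j _.
    by rewrite -big_distrr /= /t size_filter -sum1_count big_mkcond.
  rewrite big_distrr; apply: leq_sum => n _; apply: dyadic_cube_le.
  have [m0|m_gt0] := posnP (m ^ 4).
    have := fibre_quad4_le_card n; rewrite m0 leqn0 => /eqP ->.
    by rewrite expn_gt0.
  have /andP[_ +] := trunc_log_bounds (isT : 1 < 2) m_gt0; rewrite -/L.
  by move=> lt_L; apply: leq_ltn_trans lt_L; apply: fibre_quad4_le_card.
apply: (@leq_trans ((8 * \sum_(j < L) t j) ^ 2)); first by rewrite leq_sqr.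
rewrite expnMn -mulnA leq_mul2l; apply/orP; right.
rewrite -(big_mkord predT t); apply: leq_trans (sum_sqr_le _ _) _.
rewrite size_iota subn0 -mulnn -mulnA leq_mul2l; apply/orP; right.
rewrite -[X in X * c]subn0 -sum_nat_const_nat.
by apply: leq_sum => j _.
Qed.

End ThirdMoment.

(** * The divisor bound *)

Local Open Scope R_scope.

Lemma INR_muln (a b : nat) : INR (a * b)%N = INR a * INR b.
Proof. exact: mult_INR. Qed.

Lemma INR_expn (a b : nat) : INR (a ^ b)%N = INR a ^ b.
Proof. by elim: b => [|b IH] //=; rewrite expnS INR_muln IH. Qed.

Lemma INR_leq (a b : nat) : (a <= b)%N -> INR a <= INR b.
Proof. by move=> ab; apply: le_INR; apply/leP. Qed.

Lemma INR_gt0 (a : nat) : (0 < a)%N -> 0 < INR a.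
Proof. by move=> a0; apply: lt_0_INR; apply/ltP. Qed.

Lemma Rpower_INR_muln (a b : nat) (d : R) : (0 < a)%N -> (0 < b)%N ->
  Rpower (INR (a * b)%N) d = Rpower (INR a) d * Rpower (INR b) d.
Proof. by move=> a0 b0; rewrite INR_muln Rpower_mult_distr //; apply: INR_gt0. Qed.

Lemma Rpower_INR_expn (p a : nat) (d : R) : (0 < p)%N ->
  Rpower (INR (p ^ a)%N) d = Rpower (INR p) d ^ a.
Proof.
move=> p0; elim: a => [|a IH]; first by rewrite expn0 /= /Rpower ln_1 Rmult_0_r exp_0.
by rewrite expnS Rpower_INR_muln ?expn_gt0 ?p0 // IH.
Qed.

Lemma Rpower_INR_leq (a b : nat) (d : R) : 0 < d -> (0 < a <= b)%N ->
  Rpower (INR a) d <= Rpower (INR b) d.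
Proof.
move=> d0 /andP[a0 ab]; apply: Rle_Rpower_l; first exact: Rlt_le.
by split; [exact: INR_gt0 | exact: INR_leq].
Qed.

(** From exp u >= 1 + u with u = a d ln 2. It serves both for exponents of small primes and for the
    number of dyadic levels. *)
Lemma succ_le_Rpower (d : R) : 0 < d ->
  exists2 K, 1 <= K & forall a : nat, INR a.+1 <= K * Rpower (INR (2 ^ a)%N) d.
Proof.
move=> d0; have l2 : 0 < ln 2 by rewrite -ln_1; apply: ln_increasing; lra.
have dl : 0 < d * ln 2 by exact: Rmult_lt_0_compat.
have inv0 := Rinv_0_lt_compat _ dl.
exists (1 + / (d * ln 2)) => [|a]; first lra.
have -> : Rpower (INR (2 ^ a)%N) d = exp (INR a * (d * ln 2)).
  by rewrite INR_expn -[INR 2]/(2%R) /Rpower ln_pow; [congr exp; ring | lra].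
have := exp_ineq1_le (INR a * (d * ln 2)); have a0 := pos_INR a.
rewrite S_INR; set x := d * ln 2 in dl inv0 * => ineq.
apply: (Rle_trans _ ((1 + / x) * (1 + INR a * x))).
  have -> : (1 + / x) * (1 + INR a * x) = 1 + INR a + (/ x + INR a * x) by field; lra.
  by have := Rmult_le_pos _ _ a0 (Rlt_le _ _ dl); lra.
by apply: Rmult_le_compat_l; lra.
Qed.

Lemma size_divisors_mul_le (p a m : nat) : prime p -> coprime p m -> (0 < m)%N ->
  (size (divisors (p ^ a * m)) <= a.+1 * size (divisors m))%N.
Proof.
move=> pp cpm m0.
have pa0 : (0 < p ^ a)%N by rewrite expn_gt0 prime_gt0.
have n0 : (0 < p ^ a * m)%N by rewrite muln_gt0 pa0.
rewrite -{1}(size_iota 0 a.+1) -(size_allpairs (fun i d => (d * p ^ i)%N)).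
apply: uniq_leq_size (divisors_uniq _) _ => d; rewrite -dvdn_divisors // => dn.
have d0 := dvdn_gt0 n0 dn.
have [d' cpd' dE] := pfactor_coprime pp d0; rewrite dE.
apply: allpairs_f.
  rewrite mem_iota /= add0n ltnS.
  have := dvdn_leq_log p n0 dn; rewrite lognM // pfactorK // (logn_coprime cpm) addn0.
  by [].
rewrite -dvdn_divisors // -(@Gauss_dvdr d' (p ^ a)) ?coprimeXr // 1?coprime_sym //.
by apply: dvdn_trans dn; apply/dvdnP; exists (p ^ logn p d)%N; rewrite mulnC.
Qed.

(* Primes p >= b with b^d >= 2 contribute a factor a + 1 <= 2^a <= p^(a d); the
   finitely many smaller primes only cost a constant each. *)
Definition rough (b n : nat) : Prop := forall p, prime p -> (p %| n)%N -> (b <= p)%N.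

Lemma rough_divisor_bound (b : nat) (d : R) : 0 < d -> (0 < b)%N -> 2 <= Rpower (INR b) d ->
  forall n, (0 < n)%N -> rough b n -> INR (size (divisors n)) <= Rpower (INR n) d.
Proof.
move=> d0 b0 b2; elim/ltn_ind => n IH n0 rn.
have [n1|n_gt1] := leqP n 1.
  have -> : n = 1%N by apply/eqP; rewrite eqn_leq n1.
  by rewrite /Rpower ln_1 Rmult_0_r exp_0 /=; lra.
have pp := pdiv_prime n_gt1; set p := pdiv n in pp.
have pn : (p %| n)%N := pdiv_dvd n.
have [m cpm nE] := pfactor_coprime pp n0; set a := logn p n in nE.
have a0 : (0 < a)%N by rewrite logn_gt0 mem_primes pp n0.
have m0 : (0 < m)%N by move: n0; rewrite nE muln_gt0 => /andP[].
have mn : (m < n)%N by rewrite nE ltn_Pmulr // -(exp1n a) ltn_exp2r // prime_gt1.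
have rm : rough b m by move=> q pq qm; apply: rn pq _; rewrite nE dvdn_mulr.
have p0 := prime_gt0 pp.
rewrite nE mulnC Rpower_INR_muln ?expn_gt0 ?p0 // Rpower_INR_expn //.
apply: Rle_trans (INR_leq (size_divisors_mul_le a pp cpm m0)) _.
rewrite INR_muln; apply: Rmult_le_compat; [exact: pos_INR | exact: pos_INR | | exact: IH].
apply: (Rle_trans _ (2 ^ a)).
  by rewrite -[2]/(INR 2) -INR_expn; apply: INR_leq; rewrite ltn_expl.
apply: pow_incr; split; first lra.
by apply: Rle_trans b2 _; apply: Rpower_INR_leq => //; rewrite b0 rn.
Qed.

Lemma divisor_bound (d : R) : 0 < d ->
  exists2 c, 1 <= c &
    forall n, (0 < n)%N -> INR (size (divisors n)) <= c * Rpower (INR n) d.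
Proof.
move=> d0.
have [b b0 b2] : exists2 b, (0 < b)%N & 2 <= Rpower (INR b) d.
  have [b bB] := INR_unbounded (Rpower 2 (/ d)).
  have r0 : 0 < Rpower 2 (/ d) by exact: exp_pos.
  exists b; first by case: b bB => //= ?; lra.
  have {1}-> : 2 = Rpower (Rpower 2 (/ d)) d.
    by rewrite Rpower_mult Rinv_l ?Rpower_1; lra.
  by apply: Rle_Rpower_l; lra.
(* The roughness threshold is lowered one unit at a time from b, where c = 1 works, to 0, where it
   is no condition. Crossing a prime q costs a factor K; crossing a non-prime costs nothing. *)
suff claim j : exists2 c, 1 <= c & forall n, (0 < n)%N -> rough (b - j) n ->
    INR (size (divisors n)) <= c * Rpower (INR n) d.
  have [c c1 cP] := claim b; exists c => // n n0; apply: cP => // p _ _.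
  by rewrite subnn.
elim: j => [|j [c c1 IH]].
  exists 1; [lra | move=> n n0; rewrite subn0 Rmult_1_l; exact: rough_divisor_bound].
have [lt|ge] := ltnP j b; last first.
  exists c => // n n0 _; apply: IH => // p _ _.
  by move/eqP: ge => ->.
set q := (b - j.+1)%N; have qE : (b - j = q.+1)%N by rewrite /q; lia.
rewrite qE in IH.
have [pq|npq] := boolP (prime q); last first.
  exists c => // n n0 rn; apply: IH => // p pp pn.
  rewrite ltn_neqAle (rn p pp pn) andbT; apply: contraNneq npq => -> //.
have [K K1 KP] := succ_le_Rpower d0.
exists (K * c) => [|n n0 rn]; first by have := Rmult_le_compat 1 K 1 c; lra.
have [m cqm nE] := pfactor_coprime pq n0; set a := logn q n in nE.
have m0 : (0 < m)%N by move: n0; rewrite nE muln_gt0 => /andP[].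
have q0 := prime_gt0 pq.
rewrite nE mulnC Rpower_INR_muln ?expn_gt0 ?q0 //.
apply: Rle_trans (INR_leq (size_divisors_mul_le a pq cqm m0)) _.
rewrite INR_muln.
have -> (x y : R) : K * c * (x * y) = (K * x) * (c * y) by ring.
apply: Rmult_le_compat; [exact: pos_INR | exact: pos_INR | |].
  apply: Rle_trans (KP a) _; apply: Rmult_le_compat_l; first lra.
  apply: Rpower_INR_leq; rewrite // expn_gt0 /=.
  by case: (a) => [|a']; rewrite ?expn0 // leq_exp2r // prime_gt1.
apply: IH => // p pp pm; rewrite ltn_neqAle rn //; last by rewrite nE dvdn_mulr.
rewrite andbT; apply: contraTneq cqm => ->.
by rewrite prime_coprime // pm.
Qed.

(** * Fourier coefficients as counts *)

HB.instance Definition _ :=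
  Monoid.isComLaw.Build C (RtoC 0) Cplus Cplus_assoc Cplus_comm Cplus_0_l.
HB.instance Definition _ :=
  Monoid.isMulLaw.Build C (RtoC 0) Cmult Cmult_0_l Cmult_0_r.
HB.instance Definition _ :=
  Monoid.isAddLaw.Build C Cmult Cplus Cmult_plus_distr_r Cmult_plus_distr_l.

Lemma e_plus (x y : R) : e (x + y) = (e x * e y)%C.
Proof.
rewrite /e Rmult_plus_distr_l cos_plus sin_plus /Cmult /=.
by congr pair; ring.
Qed.

Lemma Cconj_e (x : R) : Cconj (e x) = e (- x).
Proof. by rewrite /e /Cconj /= -Ropp_mult_distr_r cos_neg sin_neg. Qed.

Lemma Cconj_big (I : Type) (s : seq I) (F : I -> C) :
  Cconj (\big[Cplus/RtoC 0]_(i <- s) F i) = \big[Cplus/RtoC 0]_(i <- s) Cconj (F i).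
Proof.
apply: (big_morph Cconj Cplus_conj); by rewrite /Cconj /= Ropp_0.
Qed.

Lemma sum_n_m_big (a : nat -> C) (k N : nat) :
  sum_n_m a k N = \big[Cplus/RtoC 0]_(i < N.+1 - k) a (k + i)%N.
Proof.
have [kN|Nk] := leqP k N; last first.
  have -> : (N.+1 - k = 0)%N by apply/eqP; rewrite subn_eq0.
  by rewrite big_ord0 sum_n_m_zero //; apply/ltP.
have [j ->] : exists j, N = (k + j)%N by exists (N - k)%N; rewrite subnKC.
have -> : ((k + j).+1 - k = j.+1)%N by rewrite subSn ?leq_addr // addKn.
elim: j {N kN} => [|j IH]; first by rewrite big_ord1 !addn0 sum_n_n.
rewrite big_ord_recr /= -IH addnS sum_n_Sm //.
by apply/leP; rewrite leqW // leq_addr.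
Qed.

Section Psi.

Variables (k m : nat).

Notation phi := (@diff4 k m).
Notation quad := (@quad4 k m).

Definition weyl (alpha : R) : C :=
  \big[Cplus/RtoC 0]_(i < m) e (alpha * IZR (base k i ^ 4)).

Lemma weyl_normsq (alpha : R) :
  (weyl alpha * Cconj (weyl alpha))%C =
  \big[Cplus/RtoC 0]_p e (alpha * IZR (phi p)).
Proof.
rewrite /weyl Cconj_big big_distrlr pair_bigA; apply: eq_bigr => p _ /=.
rewrite Cconj_e -e_plus /diff4 minus_IZR; congr e; ring.
Qed.

(** The squared modulus is real, so it equals its conjugate. Multiplied by the expansion in
    [weyl_normsq], this one yields the frequencies [quad4]. *)
Lemma weyl_normsq_conj (alpha : R) :
  (weyl alpha * Cconj (weyl alpha))%C =
  \big[Cplus/RtoC 0]_p e (- (alpha * IZR (phi p))).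
Proof.
rewrite -[LHS]Cconj_conj Cmult_conj Cconj_conj Cmult_comm weyl_normsq Cconj_big.
by apply: eq_bigr => p _; rewrite Cconj_e.
Qed.

Lemma weyl_fourth (alpha : R) (n : Z) :
  (RtoC (Cmod (weyl alpha) ^ 4) * e (- (alpha * IZR n)))%C =
  \big[Cplus/RtoC 0]_q e (alpha * IZR (quad q - n)).
Proof.
have -> : Cmod (weyl alpha) ^ 4 = Cmod (weyl alpha) ^ 2 * Cmod (weyl alpha) ^ 2 by ring.
rewrite RtoC_mult !Cmod2_conj {1}weyl_normsq weyl_normsq_conj.
rewrite big_distrlr pair_bigA big_distrl; apply: eq_bigr => q _ /=.
rewrite -!e_plus /quad4 !minus_IZR; congr e; ring.
Qed.

End Psi.

Lemma cos_2PI_Z (j : Z) : cos (2 * PI * IZR j) = 1.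
Proof.
have s0 : sin (IZR j * PI) = 0 by apply: sin_eq_0_1; exists j.
have -> : 2 * PI * IZR j = 2 * (IZR j * PI) by ring.
by rewrite cos_2a_sin s0; ring.
Qed.

Lemma sin_2PI_Z (j : Z) : sin (2 * PI * IZR j) = 0.
Proof.
by apply: sin_eq_0_1; exists (2 * j)%Z; rewrite mult_IZR; ring.
Qed.

(** Orthogonality, by explicit antiderivatives of the two components when j is nonzero. *)
Lemma is_RInt_e (j : Z) :
  is_RInt (V := C_R_NormedModule) (fun alpha => e (alpha * IZR j)) 0 1
    (RtoC (INR (j == 0%Z))).
Proof.
case: eqP => [->|j0] /=.
  apply: (is_RInt_ext (fun _ => RtoC 1)).
    by move=> x _; rewrite /e !Rmult_0_r cos_0 sin_0.
  have := is_RInt_const 0 1 (RtoC 1 : C_R_NormedModule).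
  suff -> : scal (1 - 0) (RtoC 1 : C_R_NormedModule) = RtoC 1 by [].
  by rewrite Rminus_0_r; apply: scal_one.
have w0 : 2 * PI * IZR j <> 0.
  have := PI_RGT_0; have := not_0_IZR j j0 => ? ?.
  by apply: Rmult_integral_contrapositive; lra.
set w := 2 * PI * IZR j in w0.
have wE x : 2 * PI * (x * IZR j) = w * x by rewrite /w; ring.
apply: is_RInt_fct_extend_pair; rewrite /e /=.
- have val : minus (sin (w * 1) / w) (sin (w * 0) / w) = 0.
    by rewrite /minus /plus /opp /= Rmult_0_r sin_0 Rmult_1_r sin_2PI_Z; field.
  rewrite -[X in is_RInt _ _ _ X]val.
  apply: (@is_RInt_derive R_CompleteNormedModule (fun x => sin (w * x) / w)
    (fun x => cos (2 * PI * (x * IZR j)))) => x _.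
    by rewrite wE; auto_derive => //; field.
  apply: (continuous_ext (fun x => cos (w * x))) => [y|]; first by rewrite wE.
  by apply: ex_derive_continuous; auto_derive.
- have val : minus (- cos (w * 1) / w) (- cos (w * 0) / w) = 0.
    by rewrite /minus /plus /opp /= Rmult_0_r cos_0 Rmult_1_r cos_2PI_Z; field.
  rewrite -[X in is_RInt _ _ _ X]val.
  apply: (@is_RInt_derive R_CompleteNormedModule (fun x => - cos (w * x) / w)
    (fun x => sin (2 * PI * (x * IZR j)))) => x _.
    by rewrite wE; auto_derive => //; field.
  apply: (continuous_ext (fun x => sin (w * x))) => [y|]; first by rewrite wE.
  by apply: ex_derive_continuous; auto_derive.
Qed.

Lemma is_RInt_big (I : Type) (s : seq I) (F : I -> R -> C) (l : I -> C) :
  (forall i, is_RInt (V := C_R_NormedModule) (F i) 0 1 (l i)) ->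
  is_RInt (V := C_R_NormedModule) (fun alpha => \big[Cplus/RtoC 0]_(i <- s) F i alpha) 0 1
    (\big[Cplus/RtoC 0]_(i <- s) l i).
Proof.
move=> Fl; elim: s => [|i s IH].
  rewrite big_nil; apply: (is_RInt_ext (fun _ => RtoC 0)) => [x _|].
    by rewrite big_nil.
  have := is_RInt_const 0 1 (RtoC 0 : C_R_NormedModule).
  by rewrite (_ : scal (1 - 0) (RtoC 0 : C_R_NormedModule) = RtoC 0) //; apply: scal_zero_r.
rewrite big_cons.
apply: (is_RInt_ext (fun x => plus (F i x : C_R_NormedModule) (\big[Cplus/RtoC 0]_(i <- s) F i x))).
  by move=> x _; rewrite big_cons.
exact: (is_RInt_plus (V := C_R_NormedModule)).
Qed.

Lemma RtoC_INR_sum (I : Type) (s : seq I) (F : I -> nat) :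
  RtoC (INR (\sum_(i <- s) F i)) = \big[Cplus/RtoC 0]_(i <- s) RtoC (INR (F i)).
Proof.
apply: (big_morph (fun x => RtoC (INR x))) => // x y.
by rewrite plus_INR RtoC_plus.
Qed.

Lemma psi4_fibre (k : nat) (P : R) (n : Z) :
  psi4 k P n =
  RtoC (INR (fibre (@quad4 k ((Z.to_nat (Int_part P)).+1 - k)) n)).
Proof.
set m := (_ - _)%N.
have fE alpha : Defs.f k P alpha = weyl k m alpha.
  rewrite /Defs.f sum_n_m_big; apply: eq_bigr => i _.
  by rewrite INR_IZR_INZ pow_IZR.
apply: (@is_RInt_unique C_R_CompleteNormedModule).
apply: (is_RInt_ext (fun alpha => \big[Cplus/RtoC 0]_q e (alpha * IZR (@quad4 k m q - n)))).
  by move=> alpha _; rewrite fE weyl_fourth.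
rewrite /fibre RtoC_INR_sum; apply: is_RInt_big => q.
have -> : (quad4 k q == n) = (quad4 k q - n == 0)%Z by apply/eqP/eqP; lia.
exact: is_RInt_e.
Qed.

Lemma is_series_finite (a : nat -> nat) (B : nat) :
  (forall j, (B <= j)%N -> a j = 0%N) ->
  is_series (V := C_R_NormedModule) (fun j => RtoC (INR (a j)))
    (RtoC (INR (\sum_(j < B) a j))).
Proof.
move=> a0.
have sumE N : sum_n (fun j => RtoC (INR (a j)) : C_R_NormedModule) N =
    RtoC (INR (\sum_(j < N.+1) a j)).
  by rewrite RtoC_INR_sum; exact: (sum_n_m_big _ 0 N).
apply: (filterlim_ext_loc (fun _ => RtoC (INR (\sum_(j < B) a j)))); last exact: filterlim_const.
exists B => N /leP BN; rewrite sumE; congr (RtoC (INR _)).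
rewrite -(big_mkord predT a) -[RHS](big_mkord predT a).
rewrite [RHS](big_cat_nat (n := B)) //; last exact: leqW.
rewrite [X in _ = (_ + X)%N]big_nat_cond [X in _ = (_ + X)%N]big1 ?addn0 //.
by move=> j /andP[/andP[/a0]].
Qed.

(** * The third moment *)

Lemma psi4_cube (k : nat) (P : R) (n : Z) :
  (psi4 k P n ^ 3)%C =
  RtoC (INR (fibre (@quad4 k ((Z.to_nat (Int_part P)).+1 - k)) n ^ 3)).
Proof. by rewrite psi4_fibre INR_expn RtoC_pow. Qed.

(** Passes from the real divisor bound to a natural number D, as the counting lemmas require, by
    taking the actual maximum. *)
Lemma divisor_max (d : R) : 0 < d ->
  exists2 c, 1 <= c & forall B : nat, (0 < B)%N -> exists D : nat,
    [/\ (0 < D)%N, INR D <= c * Rpower (INR B) d &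
        forall n, (0 < n <= B)%N -> (size (divisors n) <= D)%N].
Proof.
move=> d0; have [c c1 cP] := divisor_bound d0; exists c => // B B0.
pose D := (\max_(i < B) size (divisors i.+1))%N.
have DP n : (0 < n <= B)%N -> (size (divisors n) <= D)%N.
  case: n => // n nB.
  exact: (leq_bigmax (F := fun i : 'I_B => size (divisors i.+1)) (Ordinal nB)).
exists D; split=> //.
  by have := DP 1%N B0; apply: leq_trans.
rewrite /D; apply: (big_ind (fun x => INR x <= c * Rpower (INR B) d)).
- by apply: Rmult_le_pos; [lra | exact/Rlt_le/exp_pos].
- by move=> x y hx hy; rewrite /maxn; case: ifP.
- move=> i _; apply: Rle_trans (cP _ _) _ => //.
  apply: Rmult_le_compat_l; first lra.
  by apply: Rpower_INR_leq => //; apply: (ltn_ord i).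
Qed.

(** The ten factors Y come from L^2 and D^8; 2^21 is 2^8 from (2 D)^8 times 2^13 from m <= 2 P. *)
Lemma moment_real_bound (t L D m K c Y G R0 P : R) :
  0 <= L <= K * Y -> 0 <= D <= c * Y -> 0 <= m <= 2 * P -> 0 <= Y <= G * R0 ->
  0 <= K -> 0 <= c ->
  t ^ 2 <= 64 * L ^ 2 * (24 * (100 * (((2 * D) ^ 2) ^ 4 * m ^ 13))) ->
  t ^ 2 <= (64 * 24 * 100 * 2 ^ 21 * K ^ 2 * c ^ 8 * G ^ 10) * (R0 ^ 10 * P ^ 13).
Proof.
move=> [L0 LY] [D0 DY] [m0 mP] [Y0 YG] K0 c0 tle; apply: Rle_trans tle _.
have L2 : 0 <= L ^ 2 <= (K * (G * R0)) ^ 2.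
  split; first exact: pow_le.
  by apply: pow_incr; split=> //; apply: Rle_trans LY _; apply: Rmult_le_compat_l.
have D8 : 0 <= D ^ 8 <= (c * (G * R0)) ^ 8.
  split; first exact: pow_le.
  by apply: pow_incr; split=> //; apply: Rle_trans DY _; apply: Rmult_le_compat_l.
have m13 : 0 <= m ^ 13 <= (2 * P) ^ 13 by split; [exact: pow_le | apply: pow_incr].
have -> : 64 * L ^ 2 * (24 * (100 * (((2 * D) ^ 2) ^ 4 * m ^ 13))) =
  (64 * 24 * 100 * 2 ^ 8) * (L ^ 2 * (D ^ 8 * m ^ 13)) by ring.
have -> : 64 * 24 * 100 * 2 ^ 21 * K ^ 2 * c ^ 8 * G ^ 10 * (R0 ^ 10 * P ^ 13) =
  (64 * 24 * 100 * 2 ^ 8) * ((K * (G * R0)) ^ 2 * ((c * (G * R0)) ^ 8 * (2 * P) ^ 13)) by ring.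
apply: Rmult_le_compat_l; first by lra.
apply: Rmult_le_compat; [lra | by apply: Rmult_le_pos; lra | lra |].
by apply: Rmult_le_compat; lra.
Qed.

(** Lets both halves of the series be bounded by one use of [third_moment_le]. *)
Lemma two_sided_uniq (B : nat) :
  uniq ([seq Z.of_nat j | j <- iota 0 B] ++ [seq (- Z.of_nat j.+1)%Z | j <- iota 0 B]).
Proof.
rewrite cat_uniq !map_inj_in_uniq ?iota_uniq /= ?andbT.
- by apply/hasPn => _ /mapP[j _ ->]; apply/mapP => -[i _]; lia.
- by move=> i j _ _; lia.
- by move=> i j _ _; lia.
Qed.

Theorem theorem5p5 (k : nat) (hk : k = 0%nat \/ k = 1%nat)
    (eps : R) (heps : 0 < eps) :
  exists P0 C0 : R, 0 < P0 /\
    forall P : R, P0 <= P ->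
      exists s : C,
        is_seriesZ (fun n : Z => (psi4 k P n ^ 3)%C) s /\
        Cmod s <= C0 * Rpower P (13 / 2 + eps).
Proof.
(* Y is at most a constant times P^(4 d) and enters the squared bound ten times: 40 d = 2 eps. *)
pose d := eps / 20; have d0 : 0 < d by rewrite /d; lra.
have [c c1 cP] := divisor_max d0; have [K K1 KP] := succ_le_Rpower d0.
pose G := Rpower 64 d; pose W := 64 * 24 * 100 * 2 ^ 21 * K ^ 2 * c ^ 8 * G ^ 10.
(* Since W <= (1 + W)^2, the constant 1 + W avoids a square root. *)
exists 1, (1 + W); split; first lra.
move=> P P1; set N := Z.to_nat (Int_part P).
have [IP1 IP2] := base_Int_part P.
have IP0 : (1 <= Int_part P)%Z.
  by have : (0 < Int_part P)%Z by [apply: lt_IZR; lra]; lia.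
have NP : INR N <= P by rewrite /N INR_IZR_INZ Z2Nat.id; [lra | lia].
pose m := (N.+1 - k)%N; pose M := N.+1.
have kmM : (k + m = M)%N by rewrite /m /M; lia.
have m0 : (0 < m)%N by rewrite /m /N; lia.
have M2P : INR M <= 2 * P by rewrite /M S_INR; lra.
pose B := (4 * M ^ 4)%N.
have B0 : (0 < B)%N by rewrite /B muln_gt0 expn_gt0.
have [D [D_gt0 DY DP]] := cP B B0.
have Q0 : (0 < (2 * D) ^ 2)%N by rewrite expn_gt0 muln_gt0 D_gt0.
have divs n : n <> 0%Z -> (Z.abs n <= 4 * Z.of_nat (k + m) ^ 4)%Z ->
    (size (signed_divisors n) ^ 2 <= (2 * D) ^ 2)%N.
  move=> n0 nB; rewrite leq_sqr size_signed_divisors leq_mul2l /=; apply: DP.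
  apply/andP; split; first by lia.
  by rewrite /B -kmM; move: nB; lia.
pose psi n := fibre (@quad4 k m) n.
have psi0 n : (2 * Z.of_nat (k + m) ^ 4 < Z.abs n)%Z -> psi n = 0%N.
  move=> nB; apply/eqP; rewrite -leqn0 leqNgt; apply/negP => /fibre_quad4_gt0; lia.
(* Beyond this index [psi] vanishes in both directions, so both series are finite sums. *)
pose B' := (2 * M ^ 4).+1.
pose E1 := (\sum_(j < B') psi (Z.of_nat j) ^ 3)%N.
pose E2 := (\sum_(j < B') psi (- Z.of_nat j.+1)%Z ^ 3)%N.
exists (RtoC (INR (E1 + E2))); split.
  exists (RtoC (INR E1)), (RtoC (INR E2)); split; last split.
  - apply: (is_series_ext (V := C_R_NormedModule) (fun j => RtoC (INR (psi (Z.of_nat j) ^ 3)))).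
      by move=> j; rewrite psi4_cube.
    by apply: is_series_finite => j Bj; rewrite psi0 //; move: Bj; rewrite /B' -kmM; lia.
  - apply: (is_series_ext (V := C_R_NormedModule) (fun j => RtoC (INR (psi (- Z.of_nat j.+1)%Z ^ 3)))).
      by move=> j; rewrite psi4_cube.
    by apply: is_series_finite => j Bj; rewrite psi0 //; move: Bj; rewrite /B' -kmM; lia.
  - by rewrite plus_INR RtoC_plus.
rewrite Cmod_R Rabs_pos_eq; last exact: pos_INR.
have := third_moment_le Q0 divs (two_sided_uniq B').
rewrite big_cat !big_map -/psi.
have -> : (\sum_(j <- iota 0 B') psi (Z.of_nat j) ^ 3 = E1)%N.
  by rewrite /E1 -(big_mkord predT (fun j => psi (Z.of_nat j) ^ 3)%N) /index_iota subn0.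
have -> : (\sum_(j <- iota 0 B') psi (- Z.of_nat j.+1)%Z ^ 3 = E2)%N.
  by rewrite /E2 -(big_mkord predT (fun j => psi (- Z.of_nat j.+1)%Z ^ 3)%N) /index_iota subn0.
move=> /INR_leq; set L := (trunc_log 2 _).+1.
rewrite !(INR_muln, INR_expn).
set t := INR (E1 + E2); pose Y := Rpower (INR B) d; pose R0 := Rpower P (4 * d).
have m4 : (0 < m ^ 4)%N by rewrite expn_gt0 m0.
have mM : (m <= M)%N by rewrite -kmM leq_addl.
have LY : INR L <= K * Y.
  apply: Rle_trans (KP _) _; apply: Rmult_le_compat_l; first lra.
  apply: Rpower_INR_leq => //; rewrite expn_gt0 /=.
  have /andP[le _] := trunc_log_bounds (isT : 1 < 2)%N m4.
  apply: leq_trans le _; apply: (@leq_trans (M ^ 4)); first by rewrite leq_exp2r.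
  by rewrite leq_pmull.
have P0 : 0 < P by lra.
(* M <= 2 P gives B = 4 M^4 <= 64 P^4, whence the 64 in G. *)
have YG : Y <= G * R0.
  rewrite /G /R0 -Rpower_mult -[4]/(IZR (Z.of_nat 4)) -INR_IZR_INZ Rpower_pow //.
  rewrite Rpower_mult_distr; [|lra|exact: pow_lt].
  apply: Rle_Rpower_l; first lra.
  split; first exact: INR_gt0.
  rewrite /B INR_muln INR_expn (INR_IZR_INZ 4) -[IZR (Z.of_nat 4)]/4.
  have -> : 64 * P ^ 4 = 4 * (2 * P) ^ 4 by ring.
  by apply: Rmult_le_compat_l; [lra | apply: pow_incr; split; [exact: pos_INR|]].
have Y0 : 0 <= Y by apply/Rlt_le/exp_pos.
have mP : INR m <= 2 * P by apply: Rle_trans M2P; apply: INR_leq.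
rewrite !(INR_IZR_INZ 64, INR_IZR_INZ 24, INR_IZR_INZ 100, INR_IZR_INZ 2) => tle.
have := @moment_real_bound t (INR L) (INR D) (INR m) K c Y G R0 P.
rewrite -/W; set X := Rpower P (13 / 2 + eps).
have -> : R0 ^ 10 * P ^ 13 = X ^ 2.
  rewrite -(Rpower_pow 10 R0) ?(Rpower_pow 13 P) -?(Rpower_pow 2 X) -?(Rpower_pow 13 P);
    try exact: exp_pos; try lra.
  rewrite /R0 /X !Rpower_mult -Rpower_plus; congr Rpower.
  by rewrite !INR_IZR_INZ /d /=; field.
move=> /(_ (conj (pos_INR _) LY) (conj (pos_INR _) DY) (conj (pos_INR _) mP) (conj Y0 YG)).
move=> /(_ ltac:(lra) ltac:(lra) tle) tX.
have W0 : 0 <= W.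
  rewrite /W; have G0 : 0 <= G by apply/Rlt_le/exp_pos.
  by repeat apply: Rmult_le_pos; try apply: pow_le; lra.
have X0 : 0 < X by apply: exp_pos.
apply: (Rsqr_incr_0_var t); last by apply: Rmult_le_pos; lra.
rewrite !Rsqr_pow2 Rpow_mult_distr; apply: Rle_trans tX _.
apply: Rmult_le_compat_r; first exact: pow2_ge_0.
by nra.
Qed.
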